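(* Let $\underline{z}_{STD+}$ be the optimal value of the linear relaxation of the formulation $STD$ with all inequalities (A1), (A2), (A3) added, and let $\underline{z}_{3LF+}$ be the optimal value of the linear relaxation of the formulation $3LF$ with all inequalities (B1), (B2), (B3) added (formulations and inequality families as defined in the context). Then $$\underline{z}_{STD+}\ \le\ \underline{z}_{3LF+}.$$
   Context: Problem data (uncapacitated three-level lot-sizing and replenishment problem with a distribution structure). $T=\{1,\ldots,|T|\}$ is a finite set of consecutive periods. $F=P\cup W\cup R$ is a finite set of facilities (disjoint union), with $P=\{p\}$ (plant, level 0), $W$ the warehouses (level 1), $R$ the retailers (level 2). Each retailer $r\in R$ has a unique warehouse $\delta_w(r)\in W$; for $w\in W$, $\delta(w)=\{r\in R:\delta_w(r)=w\}$; and $\delta(p)=W$. Successors at level $b'$: $\delta^1(p)=W$, $\delta^2(p)=R$, $\delta^2(w)=\delta(w)$ for $w\in W$. Also $\delta^0_w(r)=p$, $\delta^1_w(r)=\delta_w(r)$, $\delta^2_w(r)=r$. Data: setup costs $sc^i_t\ge 0$, holding costs $hc^i_t\ge 0$ ($i\in F,t\in T$), demands $d^r_t\ge 0$ ($r\in R$, $t\in T$). Put $d^p_t=\sum_{r\in R}d^r_t$, $d^w_t=\sum_{r\in\delta(w)}d^r_t$ for $w\in W$, and $d^i_{kt}=\sum_{l=k}^{t}d^i_l$ for $i\in F$, $1\le k\le t\le|T|$. All stocks at time $0$ are $0$. Formulation $STD$: minimize $\sum_{t\in T}\big(\sum_{i\in F}sc^i_ty^i_t+\sum_{i\in F}hc^i_ts^i_t\big)$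 over $(x^i_t,s^i_t,y^i_t)_{i\in F,t\in T}$ subject to - $s^i_{t-1}+x^i_t=\sum_{j\in\delta(i)}x^j_t+s^i_t$ for $i\in P\cup W$, $t\in T$; - $s^r_{t-1}+x^r_t=d^r_t+s^r_t$ for $r\in R$, $t\in T$; - $x^i_t\le d^i_{t|T|}y^i_t$, $x^i_t,s^i_t\ge0$, $y^i_t\in\{0,1\}$ for $i\in F$, $t\in T$. Formulation $3LF$: minimize $\sum_{t\in T}\big(\sum_{i\in F}sc^i_ty^i_t+\sum_{r\in R}hc^p_ts^{0r}_t+\sum_{r\in R}hc^{\delta_w(r)}_ts^{1r}_t+\sum_{r\in R}hc^r_ts^{2r}_t\big)$ over $(x^{br}_t,s^{br}_t)_{b\in\{0,1,2\},r\in R,t\in T}$ and $(y^i_t)_{i\in F,t\in T}$ subject to, for all $r\in R$, $t\in T$, - $s^{0r}_{t-1}+x^{0r}_t=x^{1r}_t+s^{0r}_t$, $\ s^{1r}_{t-1}+x^{1r}_t=x^{2r}_t+s^{1r}_t$, $\ s^{2r}_{t-1}+x^{2r}_t=d^r_t+s^{2r}_t$; - $x^{0r}_t\le d^r_{t|T|}y^p_t$, $\ x^{1r}_t\le d^r_{t|T|}y^{\delta_w(r)}_t$, $\ x^{2r}_t\le d^r_{t|T|}y^r_t$; - $x^{br}_t,s^{br}_t\ge0$ for $b\in\{0,1,2\}$; and $y^i_t\in\{0,1\}$ for $i\in F$. The linear relaxation of either formulation replaces $y^i_t\in\{0,1\}$ by $0\le y^i_t\le1$. Inequalities for $STD$: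 (A1) for every $i\in F$, $l\in T$, $L^i=\{1,\ldots,l\}$, $S^i\subseteq L^i$: $\sum_{k\in L^i\setminus S^i}x^i_k+\sum_{k\in S^i}d^i_{kl}y^i_k\ge d^i_{1l}$. (A2) for every $i\in P\cup W$ of level $b$, level $b'>b$ ($b'\le 2$), $l\in\{2,\ldots,|T|\}$, $1\le l_i<l$, $L^i=\{1,\ldots,l_i\}$, $S^i\subseteq L^i$, and, for each $j\in\delta^{b'}(i)$, $L^j=\{l_i+1,\ldots,l\}$, $S^j\subseteq L^j$: $\sum_{k\in L^i\setminus S^i}x^i_k+\sum_{k\in S^i}d^i_{kl}y^i_k+\sum_{j\in\delta^{b'}(i)}\big(\sum_{k\in L^j\setminus S^j}x^j_k+\sum_{k\in S^j}d^j_{kl}y^j_k\big)\ge d^i_{1l}$. (A3) for every $l\in\{3,\ldots,|T|\}$, $1\le l_p\le l-2$, $L^p=\{1,\ldots,l_p\}$, $S^p\subseteq L^p$; for each $w\in W$, $l_p+1\le l_w\le l-1$, $L^w=\{l_p+1,\ldots,l_w\}$, $S^w\subseteq L^w$; for each $r\in R$ with $w=\delta_w(r)$, $L^r=\{l_w+1,\ldots,l\}$, $S^r\subseteq L^r$: $\sum_{k\in L^p\setminus S^p}x^p_k+\sum_{k\in S^p}d^p_{kl}y^p_k+\sum_{w\in W}\big(\sum_{k\in L^w\setminus S^w}x^w_k+\sum_{k\in S^w}d^w_{kl}y^w_k\big)+\sum_{r\in R}\big(\sum_{k\in L^r\setminus S^r}x^r_k+\sum_{k\in S^r}d^r_{kl}y^r_k\big)\ge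 d^p_{1l}$. Inequalities for $3LF$: (B1) for every $r\in R$, $b\in\{0,1,2\}$, $l\in T$, $L^b=\{1,\ldots,l\}$, $S^b\subseteq L^b$: $\sum_{k\in L^b\setminus S^b}x^{br}_k+\sum_{k\in S^b}d^r_{kl}y^{\delta^b_w(r)}_k\ge d^r_{1l}$. (B2) for every $r\in R$, levels $b<b'$ in $\{0,1,2\}$, $l\in\{2,\ldots,|T|\}$, $1\le l_b<l$, $L^b=\{1,\ldots,l_b\}$, $S^b\subseteq L^b$, $L^{b'}=\{l_b+1,\ldots,l\}$, $S^{b'}\subseteq L^{b'}$: $\sum_{k\in L^b\setminus S^b}x^{br}_k+\sum_{k\in S^b}d^r_{kl}y^{\delta^b_w(r)}_k+\sum_{k\in L^{b'}\setminus S^{b'}}x^{b'r}_k+\sum_{k\in S^{b'}}d^r_{kl}y^{\delta^{b'}_w(r)}_k\ge d^r_{1l}$. (B3) for every $r\in R$, $l\in\{3,\ldots,|T|\}$, $1\le l_0<l-1$, $l_0+1\le l_1<l$, $L^0=\{1,\ldots,l_0\}$, $L^1=\{l_0+1,\ldots,l_1\}$, $L^2=\{l_1+1,\ldots,l\}$, $S^b\subseteq L^b$ ($b=0,1,2$): $\sum_{b=0}^{2}\big(\sum_{k\in L^b\setminus S^b}x^{br}_k+\sum_{k\in S^b}d^r_{kl}y^{\delta^b_w(r)}_k\big)\ge d^r_{1l}$. *)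

(* Defs.v *)
From HB Require Import structures.
From mathcomp Require Import all_boot all_order all_algebra.
From mathcomp Require Import classical_sets reals constructive_ereal ereal.

Set Implicit Arguments.
Unset Strict Implicit.
Unset Printing Implicit Defensive.

Import Order.TTheory GRing.Theory Num.Theory.
Local Open Scope ring_scope.

(* The disjoint union P + W + R, with P a singleton. *)
Inductive facility (W R : Type) : Type :=
  | Plant
  | Warehouse of W
  | Retailer of R.
Arguments Plant {W R}.
Arguments Warehouse {W R} w.
Arguments Retailer {W R} r.

Definition facility_encode (W R : Type) (i : facility W R) : option (W + R) :=
  match i with
  | Plant => None
  | Warehouse w => Some (inl w)
  | Retailer r => Some (inr r)
  end.

Definition facility_decode (W R : Type) (e : option (W + R)) : facility W R :=
  match e with
  | None => Plant
  | Some (inl w) => Warehouse w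
  | Some (inr r) => Retailer r
  end.

Lemma facility_encodeK (W R : Type) :
  cancel (@facility_encode W R) (@facility_decode W R).
Proof. by case. Qed.

HB.instance Definition _ (W R : finType) :=
  Finite.copy (facility W R) (can_type (@facility_encodeK W R)).

(* Periods are the ordinals t : 'I_n with n = |T|; the ordinal of value t is
   period t + 1 of T = {1, ..., |T|}. *)
Record instance (K : realType) : Type := Instance {
  horizon : nat;
  warehouse : finType;
  retailer : finType;
  supplier : retailer -> warehouse;
  setup : facility warehouse retailer -> 'I_horizon -> K;
  holding : facility warehouse retailer -> 'I_horizon -> K;
  rdemand : retailer -> 'I_horizon -> K;
  setup_ge0 : forall i t, 0 <= setup i t;
  holding_ge0 : forall i t, 0 <= holding i t;
  rdemand_ge0 : forall r t, 0 <= rdemand r t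
}.
Arguments supplier {K i} r : rename.
Arguments setup {K i} j t : rename.
Arguments holding {K i} j t : rename.
Arguments rdemand {K i} r t : rename.

Notation period I := 'I_(horizon I) (only parsing).
Notation fac I := (facility (warehouse I) (retailer I)) (only parsing).

Definition plevel (W R : Type) (i : facility W R) : nat :=
  match i with Plant => 0 | Warehouse _ => 1 | Retailer _ => 2 end%N.

Definition level0 : 'I_3 := @Ordinal 3 0 isT.
Definition level1 : 'I_3 := @Ordinal 3 1 isT.
Definition level2 : 'I_3 := @Ordinal 3 2 isT.

Section Network.
Context {K : realType} {I : instance K}.
Implicit Types (i : fac I) (r : retailer I) (t : period I).

(* delta_w^b(r) *)
Definition fac_at (b : 'I_3) r : fac I :=
  match val b with
  | 0 => Plant
  | 1 => Warehouse (supplier r)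
  | _ => Retailer r
  end%N.

Definition retailers_of (w : warehouse I) : {set fac I} :=
  [set Retailer r | r in [set r : retailer I | supplier r == w]].

Definition succs i : {set fac I} :=
  match i with
  | Plant => [set Warehouse w | w in [set: warehouse I]]
  | Warehouse w => retailers_of w
  | Retailer _ => finset.set0
  end.

(* delta^b'(i); only used when plevel i < b' <= 2. *)
Definition succs_at (b' : nat) i : {set fac I} :=
  match i, b' with
  | Plant, 1 => [set Warehouse w | w in [set: warehouse I]]
  | Plant, 2 => [set Retailer r | r in [set: retailer I]]
  | Warehouse w, 2 => retailers_of w
  | _, _ => finset.set0
  end%N.

Definition demand i t : K :=
  match i with
  | Plant => \sum_(r : retailer I) rdemand r t
  | Warehouse w => \sum_(r : retailer I | supplier r == w) rdemand r t
  | Retailer r => rdemand r t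
  end.

(* Bounds follow the shifted numbering of periods: d^i_{1l} is cdemand i 0 l
   and d^i_{t|T|} is cdemand i t (horizon I).-1. *)
Definition cdemand i (k l : nat) : K :=
  \sum_(u : period I | (k <= u <= l)%N) demand i u.

Definition cdemand_end i t : K := cdemand i t (horizon I).-1.

(* s_{t-1}, the stock at time 0 being 0. *)
Definition prev_stock (s : period I -> K) t : K :=
  if val t == 0%N then 0 else s (ord_pred t).

(* {1, ..., l} and {a + 1, ..., l} *)
Definition periods_upto (l : period I) : {set period I} :=
  [set k : period I | (k <= l)%N].
Definition periods_between (a l : period I) : {set period I} :=
  [set k : period I | (a < k <= l)%N].

(* sum_{k in L \ S} x_k + sum_{k in S} d^i_{kl} y_k *)
Definition ls_term i (l : period I) (L S : {set period I})
    (x y : period I -> K) : K :=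
  \sum_(k in L :\: S) x k + \sum_(k in S) cdemand i k l * y k.

End Network.

(* Infimum over the feasible set, +oo when it is empty. The two programs below
   are feasible linear programs with nonnegative cost, hence the infimum is an
   attained minimum. *)
Definition optimal_value (K : realType) (V : Type) (obj : V -> K)
    (feasible : V -> Prop) : \bar K :=
  ereal_inf [set z | exists2 v : V, feasible v & z = (obj v)%:E]%classic.

Record std_vars (K : realType) (I : instance K) : Type := StdVars {
  xS : fac I -> period I -> K;
  sS : fac I -> period I -> K;
  yS : fac I -> period I -> K
}.

Record lf_vars (K : realType) (I : instance K) : Type := LfVars {
  xL : 'I_3 -> retailer I -> period I -> K;
  sL : 'I_3 -> retailer I -> period I -> K;
  yL : fac I -> period I -> K
}.

Section Formulations.
Context {K : realType} {I : instance K}.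

Definition std_cost (v : std_vars I) : K :=
  \sum_(t : period I)
    (\sum_(i : fac I) setup i t * yS v i t
     + \sum_(i : fac I) holding i t * sS v i t).

Record std_relaxation (v : std_vars I) : Prop := StdRelaxation {
  std_balance : forall (i : fac I) (t : period I), (plevel i < 2)%N ->
    prev_stock (sS v i) t + xS v i t = \sum_(j in succs i) xS v j t + sS v i t;
  std_retailer_balance : forall (r : retailer I) (t : period I),
    prev_stock (sS v (Retailer r)) t + xS v (Retailer r) t
      = rdemand r t + sS v (Retailer r) t;
  std_setup : forall (i : fac I) (t : period I),
    xS v i t <= cdemand_end i t * yS v i t;
  std_x_ge0 : forall (i : fac I) (t : period I), 0 <= xS v i t;
  std_s_ge0 : forall (i : fac I) (t : period I), 0 <= sS v i t;
  std_y_unit : forall (i : fac I) (t : period I), 0 <= yS v i t <= 1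
}.

Definition std_ineq1 (v : std_vars I) : Prop :=
  forall (i : fac I) (l : period I) (S : {set period I}),
    S \subset periods_upto l ->
    ls_term i l (periods_upto l) S (xS v i) (yS v i) >= cdemand i 0 l.

Definition std_ineq2 (v : std_vars I) : Prop :=
  forall (i : fac I) (b' : nat) (l li : period I)
         (S : fac I -> {set period I}),
    (plevel i < b' <= 2)%N -> (li < l)%N ->
    S i \subset periods_upto li ->
    (forall j, j \in succs_at b' i -> S j \subset periods_between li l) ->
    ls_term i l (periods_upto li) (S i) (xS v i) (yS v i)
    + \sum_(j in succs_at b' i)
        ls_term j l (periods_between li l) (S j) (xS v j) (yS v j)
    >= cdemand i 0 l.

Definition std_ineq3 (v : std_vars I) : Prop :=
  forall (l lp : period I) (lw : warehouse I -> period I)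
         (S : fac I -> {set period I}),
    (lp.+1 < l)%N -> (forall w, (lp < lw w < l)%N) ->
    S Plant \subset periods_upto lp ->
    (forall w, S (Warehouse w) \subset periods_between lp (lw w)) ->
    (forall r, S (Retailer r) \subset periods_between (lw (supplier r)) l) ->
    ls_term Plant l (periods_upto lp) (S Plant) (xS v Plant) (yS v Plant)
    + \sum_(w : warehouse I)
        ls_term (Warehouse w) l (periods_between lp (lw w)) (S (Warehouse w))
          (xS v (Warehouse w)) (yS v (Warehouse w))
    + \sum_(r : retailer I)
        ls_term (Retailer r) l (periods_between (lw (supplier r)) l)
          (S (Retailer r)) (xS v (Retailer r)) (yS v (Retailer r))
    >= cdemand (Plant : fac I) 0 l.

Definition std_plus (v : std_vars I) : Prop :=
  [/\ std_relaxation v, std_ineq1 v, std_ineq2 v & std_ineq3 v].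

Definition lf_cost (v : lf_vars I) : K :=
  \sum_(t : period I)
    (\sum_(i : fac I) setup i t * yL v i t
     + \sum_(r : retailer I) holding Plant t * sL v level0 r t
     + \sum_(r : retailer I) holding (Warehouse (supplier r)) t
                               * sL v level1 r t
     + \sum_(r : retailer I) holding (Retailer r) t * sL v level2 r t).

Record lf_relaxation (v : lf_vars I) : Prop := LfRelaxation {
  lf_balance0 : forall (r : retailer I) (t : period I),
    prev_stock (sL v level0 r) t + xL v level0 r t
      = xL v level1 r t + sL v level0 r t;
  lf_balance1 : forall (r : retailer I) (t : period I),
    prev_stock (sL v level1 r) t + xL v level1 r t
      = xL v level2 r t + sL v level1 r t;
  lf_balance2 : forall (r : retailer I) (t : period I),
    prev_stock (sL v level2 r) t + xL v level2 r t
      = rdemand r t + sL v level2 r t;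
  lf_setup : forall (b : 'I_3) (r : retailer I) (t : period I),
    xL v b r t <= cdemand_end (Retailer r) t * yL v (fac_at b r) t;
  lf_x_ge0 : forall (b : 'I_3) (r : retailer I) (t : period I),
    0 <= xL v b r t;
  lf_s_ge0 : forall (b : 'I_3) (r : retailer I) (t : period I),
    0 <= sL v b r t;
  lf_y_unit : forall (i : fac I) (t : period I), 0 <= yL v i t <= 1
}.

Definition lf_term (v : lf_vars I) (b : 'I_3) (r : retailer I)
    (l : period I) (L S : {set period I}) : K :=
  ls_term (Retailer r) l L S (xL v b r) (yL v (fac_at b r)).

Definition lf_ineq1 (v : lf_vars I) : Prop :=
  forall (r : retailer I) (b : 'I_3) (l : period I) (S : {set period I}),
    S \subset periods_upto l ->
    lf_term v b r l (periods_upto l) S >= cdemand (Retailer r) 0 l.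

Definition lf_ineq2 (v : lf_vars I) : Prop :=
  forall (r : retailer I) (b b' : 'I_3) (l lb : period I)
         (S S' : {set period I}),
    (b < b')%N -> (lb < l)%N ->
    S \subset periods_upto lb -> S' \subset periods_between lb l ->
    lf_term v b r l (periods_upto lb) S
    + lf_term v b' r l (periods_between lb l) S'
    >= cdemand (Retailer r) 0 l.

Definition lf_ineq3 (v : lf_vars I) : Prop :=
  forall (r : retailer I) (l l0 l1 : period I) (S0 S1 S2 : {set period I}),
    (l0 < l1 < l)%N ->
    S0 \subset periods_upto l0 -> S1 \subset periods_between l0 l1 ->
    S2 \subset periods_between l1 l ->
    lf_term v level0 r l (periods_upto l0) S0
    + lf_term v level1 r l (periods_between l0 l1) S1
    + lf_term v level2 r l (periods_between l1 l) S2
    >= cdemand (Retailer r) 0 l.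

Definition lf_plus (v : lf_vars I) : Prop :=
  [/\ lf_relaxation v, lf_ineq1 v, lf_ineq2 v & lf_ineq3 v].

End Formulations.

Definition z_std_plus (K : realType) (I : instance K) : \bar K :=
  optimal_value (@std_cost K I) std_plus.

Definition z_lf_plus (K : realType) (I : instance K) : \bar K :=
  optimal_value (@lf_cost K I) lf_plus.

(* Main.v *)
(** Summing a feasible point of the multi-commodity formulation over the
    retailers served by each facility gives a feasible point of the aggregate
    formulation with the same cost.  Every inequality of the aggregate
    formulation is the sum of the inequalities of the other one over the
    retailers served by the facility at its root, with the sets S of retailer r
    taken to be those of the facilities on the path from the plant to r. *)

Require Import Defs.
From HB Require Import structures.
From mathcomp Require Import all_boot all_order all_algebra.
From mathcomp Require Import classical_sets reals constructive_ereal ereal.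

Set Implicit Arguments.
Unset Strict Implicit.
Unset Printing Implicit Defensive.

Import Order.TTheory GRing.Theory Num.Theory.
Local Open Scope ring_scope.

Definition level (W R : Type) (i : facility W R) : 'I_3 :=
  match i with
  | Plant => level0
  | Warehouse _ => level1
  | Retailer _ => level2
  end.

Section Aggregation.
Context {K : realType} {I : instance K}.
Implicit Types (i j : fac I) (r : retailer I) (t l : period I).

(** Says that [i] lies on the path from the plant to [r]. A single test for all three levels lets
    most sums be handled without a case split on [i]. *)
Definition serves i r : bool := fac_at (level i) r == i.

Lemma servesP i r : reflect (fac_at (level i) r = i) (serves i r).
Proof. exact: eqP. Qed.

Lemma val_level i : level i = plevel i :> nat.
Proof. by case: i. Qed.

Lemma level_fac_at (b : 'I_3) r : level (fac_at b r) = b.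
Proof. by apply: val_inj; case: b => [[|[|[|]]]]. Qed.

Lemma Warehouse_inj : injective (@Warehouse (warehouse I) (retailer I)).
Proof. by move=> ? ? []. Qed.

Lemma Retailer_inj : injective (@Retailer (warehouse I) (retailer I)).
Proof. by move=> ? ? []. Qed.

Lemma serves_Plant r : serves Plant r.
Proof. exact/servesP. Qed.

Lemma serves_Warehouse w r : serves (Warehouse w) r = (supplier r == w).
Proof. exact: (inj_eq Warehouse_inj). Qed.

Lemma serves_Retailer r' r : serves (Retailer r') r = (r == r').
Proof. exact: (inj_eq Retailer_inj). Qed.

Lemma sum_serves_Plant (F : retailer I -> K) :
  \sum_(r | serves Plant r) F r = \sum_r F r.
Proof. by apply: eq_bigl => r; rewrite serves_Plant. Qed.

Lemma sum_serves_Warehouse w (F : retailer I -> K) :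
  \sum_(r | serves (Warehouse w) r) F r = \sum_(r | supplier r == w) F r.
Proof. by apply: eq_bigl => r; rewrite serves_Warehouse. Qed.

Lemma sum_serves_Retailer r (F : retailer I -> K) :
  \sum_(r' | serves (Retailer r) r') F r' = F r.
Proof. by under eq_bigl do rewrite serves_Retailer; rewrite big_pred1_eq. Qed.

Lemma demandE i t : demand i t = \sum_(r | serves i r) rdemand r t.
Proof.
by case: i => [|w|r];
  rewrite ?sum_serves_Plant ?sum_serves_Warehouse ?sum_serves_Retailer.
Qed.

Lemma cdemandE i k m :
  cdemand i k m = \sum_(r | serves i r) cdemand (Retailer r : fac I) k m.
Proof. by rewrite exchange_big; apply: eq_bigr => u _; rewrite demandE. Qed.

Lemma succs_succs_at i : (plevel i < 2)%N -> succs i = succs_at (plevel i).+1 i.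
Proof. by case: i. Qed.

(** This is the tree property of the network: a path reaches the descendants of [i] only by passing
    through [i]. *)
Lemma fac_at_succs (b : 'I_3) i r : (plevel i < b)%N ->
  (fac_at b r \in succs_at b i) = serves i r.
Proof.
case: b => [[|[|[|//]]] ltb3]; case: i => [|w|r'] //= _.
- by rewrite serves_Plant (mem_imset _ _ Warehouse_inj) inE.
- by rewrite serves_Plant (mem_imset _ _ Retailer_inj) inE.
- by rewrite serves_Warehouse (mem_imset _ _ Retailer_inj) inE.
Qed.

Lemma level_succs_at b i j : j \in succs_at b i -> plevel j = b.
Proof.
case: i => [|w|r]; case: b => [|[|[|b]]] //=; rewrite ?inE //.
- by case/imsetP=> w _ ->.
- by case/imsetP=> r _ ->.
- by case/imsetP=> r _ ->.
Qed.

(** The retailers served by [i] are partitioned according to the facility at level [b] on their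
    path. *)
Lemma sum_succs_at (b : 'I_3) i (G : fac I -> retailer I -> K) :
    (plevel i < b)%N ->
  \sum_(j in succs_at b i) \sum_(r | serves j r) G j r
    = \sum_(r | serves i r) G (fac_at b r) r.
Proof.
move=> ltib; rewrite (partition_big (fac_at b) (mem (succs_at b i))) /=.
  apply: eq_bigr => j jb.
  have lj : level j = b by apply: val_inj; rewrite /= val_level (level_succs_at jb).
  rewrite (eq_bigl (fun r => serves i r && (fac_at b r == j))).
    by apply: eq_bigr => r /andP[_ /eqP->].
  move=> r; rewrite /serves lj; case: eqP => [rj|]; last by rewrite andbF.
  by rewrite -/(serves i r) -(fac_at_succs _ ltib) rj jb.
by move=> r; rewrite fac_at_succs.
Qed.

Lemma sum_facilities (G : fac I -> retailer I -> K) :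
  \sum_i \sum_(r | serves i r) G i r
    = \sum_(b < 3) \sum_r G (fac_at b r) r.
Proof.
rewrite (exchange_big_dep predT) //= [RHS]exchange_big.
(* For fixed [r], [level] inverts [fac_at] on the path to [r], which has one facility per level. *)
apply: eq_bigr => r _; rewrite (reindex_onto (fun b => fac_at b r) (@level _ _)).
  by apply: eq_bigl => b; rewrite /serves level_fac_at !eqxx.
by move=> i /servesP.
Qed.

Lemma ls_term_sum i l (L S : {set period I}) (x : retailer I -> period I -> K)
    (y : period I -> K) :
  ls_term i l L S (fun t => \sum_(r | serves i r) x r t) y
    = \sum_(r | serves i r) ls_term (Retailer r : fac I) l L S (x r) y.
Proof.
rewrite /ls_term big_split /=; congr (_ + _); first exact: exchange_big.
rewrite exchange_big; apply: eq_bigr => k _.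
by rewrite cdemandE mulr_suml.
Qed.

Lemma prev_stock_sum i (s : retailer I -> period I -> K) t :
  prev_stock (fun u => \sum_(r | serves i r) s r u) t
    = \sum_(r | serves i r) prev_stock (s r) t.
(* In the first period every previous stock is 0, and so is their sum. *)
Proof. by rewrite /prev_stock; case: eqP => // _; rewrite big1. Qed.

(** Flows and stocks are summed, but setups are kept: both formulations index them by facility. *)
Definition aggregate (v : lf_vars I) : std_vars I := StdVars
  (fun i t => \sum_(r | serves i r) xL v (level i) r t)
  (fun i t => \sum_(r | serves i r) sL v (level i) r t)
  (yL v).

Lemma std_cost_aggregate (v : lf_vars I) : std_cost (aggregate v) = lf_cost v.
Proof.
apply: eq_bigr => t _; rewrite -!addrA; congr (_ + _) => /=.
under eq_bigr do rewrite mulr_sumr.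
rewrite (sum_facilities (fun i r => holding i t * sL v (level i) r t)).
rewrite !big_ord_recl big_ord0 addr0.
by congr (_ + (_ + _)); apply: eq_bigr => r _; rewrite level_fac_at;
  congr (holding _ _ * sL v _ _ _); apply: val_inj.
Qed.

(** Merges the balances of the two upper levels, so that plant and warehouses are aggregated by one
    argument. *)
Lemma lf_balance (v : lf_vars I) (b b' : 'I_3) r t :
    lf_relaxation v -> b' = b.+1 :> nat ->
  prev_stock (sL v b r) t + xL v b r t = xL v b' r t + sL v b r t.
Proof.
case: b b' => [[|[|[|//]]] b3] [[|[|[|//]]] b'3] [bal0 bal1 _ _ _ _ _] //= _.
- rewrite (_ : Ordinal b3 = level0); last exact: val_inj.
  by rewrite (_ : Ordinal b'3 = level1) ?bal0 //; apply: val_inj.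
- rewrite (_ : Ordinal b3 = level1); last exact: val_inj.
  by rewrite (_ : Ordinal b'3 = level2) ?bal1 //; apply: val_inj.
Qed.

Lemma aggregate_relaxation (v : lf_vars I) :
  lf_relaxation v -> std_relaxation (aggregate v).
Proof.
move=> vP; have [_ _ bal2 setupP x0 s0 y01] := vP; split=> //=.
- move=> i t lti; rewrite prev_stock_sum -big_split /= succs_succs_at //.
  have ltb : ((plevel i).+1 < 3)%N by [].
  rewrite (sum_succs_at (b := Ordinal ltb) (fun j r => xL v (level j) r t)) //.
  rewrite -big_split; apply: eq_bigr => r _ /=; rewrite level_fac_at.
  by apply: lf_balance => //=; rewrite val_level.
- by move=> r t; rewrite prev_stock_sum !sum_serves_Retailer.
- move=> i t; rewrite /cdemand_end cdemandE mulr_suml; apply: ler_sum => r /servesP ir.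
  by rewrite -[in yL v i t]ir; apply: setupP.
- by move=> i t; apply: sumr_ge0.
- by move=> i t; apply: sumr_ge0.
Qed.

(** All retailers served by [i] share its setup variables, and the coefficients of these are
    additive in the demands. *)
Lemma ls_term_aggregate (v : lf_vars I) i l (L S : {set period I}) :
  ls_term i l L S (xS (aggregate v) i) (yS (aggregate v) i)
    = \sum_(r | serves i r) lf_term v (level i) r l L S.
Proof.
rewrite ls_term_sum; apply: eq_bigr => r /servesP ir.
by rewrite /lf_term ir.
Qed.

Lemma aggregate_ineq1 (v : lf_vars I) : lf_ineq1 v -> std_ineq1 (aggregate v).
Proof.
move=> vP i l S SL; rewrite ls_term_aggregate cdemandE.
by apply: ler_sum => r _; apply: vP.
Qed.

Lemma aggregate_ineq2 (v : lf_vars I) : lf_ineq2 v -> std_ineq2 (aggregate v).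
Proof.
move=> vP i b' l li S /andP[ltib leb2] ltl Si Sj.
under eq_bigr do rewrite ls_term_aggregate.
have ltb : (b' < 3)%N by [].
rewrite (sum_succs_at (b := Ordinal ltb) (fun j r =>
  lf_term v (level j) r l (periods_between li l) (S j))) //.
rewrite ls_term_aggregate -big_split cdemandE; apply: ler_sum => r ir /=.
rewrite level_fac_at; apply: vP => //=; first by rewrite val_level.
(* The second set for [r] is that of its facility at level [b'], a successor of [i] because [i]
   serves [r]. *)
by apply: Sj; rewrite (fac_at_succs (b := Ordinal ltb)).
Qed.

Lemma aggregate_ineq3 (v : lf_vars I) : lf_ineq3 v -> std_ineq3 (aggregate v).
Proof.
move=> vP l lp lw S ltl lwP Sp Sw Sr.
under [X in _ + X + _]eq_bigr do
  rewrite ls_term_aggregate sum_serves_Warehouse.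
under [X in _ + X]eq_bigr do rewrite ls_term_aggregate sum_serves_Retailer.
rewrite ls_term_aggregate cdemandE !sum_serves_Plant.
(* Grouping by supplier gives each retailer the breakpoint and set of its own warehouse. *)
have -> : \sum_w \sum_(r | supplier r == w) lf_term v level1 r l
    (periods_between lp (lw w)) (S (Warehouse w)) =
  \sum_r lf_term v level1 r l (periods_between lp (lw (supplier r)))
    (S (Warehouse (supplier r))).
  rewrite [RHS](partition_big (@supplier _ I) predT) //=.
  by apply: eq_bigr => w _; apply: eq_bigr => r /eqP->.
by rewrite -!big_split; apply: ler_sum => r _; apply: vP.
Qed.

Lemma aggregate_plus (v : lf_vars I) : lf_plus v -> std_plus (aggregate v).
Proof.
case=> vR v1 v2 v3; split; [exact: aggregate_relaxation|exact: aggregate_ineq1|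
  exact: aggregate_ineq2|exact: aggregate_ineq3].
Qed.

End Aggregation.

Theorem proposition11 (K : realType) (I : instance K) :
  (z_std_plus I <= z_lf_plus I)%E.
Proof.
(* Infima reverse inclusion, so it suffices that every cost attained in the multi-commodity program
   is attained in the aggregate one. *)
apply: ereal_inf_le_tmp => _ [v vP ->].
by exists (aggregate v); [exact: aggregate_plus | rewrite std_cost_aggregate].
Qed.
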